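(* Let $0<\nu<1$, $T>0$, let $k,f$ be sufficiently smooth functions on $[0,1]\times[0,T]$ with $0<c_1\le k(x,t)\le c_2$ and $k(x,t)=k(1-x,t)$, let $\mu\in C[0,T]$, let $\alpha,\beta,\gamma$ be real numbers such that either 1) $|\alpha|<1$, $|\beta|<1$ and $\gamma\le0$; or 2) $|\alpha|>1$, $|\beta|>1$ and $\alpha\beta\gamma\le0$, and let $u_0:[0,1]\to\mathbb{R}$ satisfy $u_0(0)=\alpha u_0(1)$. Then the following difference scheme is absolutely stable. That is, there is a constant $M_3>0$, depending only on $\alpha,\beta,\gamma,\nu,c_1,c_2$ (and independent of $h$, $\tau$, $T$, $f$, $\mu$, $u_0$), such that for all integers $N\ge2$, $N_T\ge1$, with $h=1/N$, $\tau=T/N_T$ (and no relation between $h$ and $\tau$ required), every solution $(y_i^n)_{0\le i\le N,\,0\le n\le N_T}$ of $$\Delta_{0t_{n+\sigma}}^{\nu}y_i-(a y_{\bar x}^{(\sigma)})_{x,i}=\varphi_i^n,\quad i=1,\dots,N-1,\ 0\le n\le N_T-1,$$ $$y_0^{n+1}-\alpha y_N^{n+1}=0,\quad 0\le n\le N_T-1,$$ $$\beta\Delta_{0t_{n+\sigma}}^{\nu}y_0+\Delta_{0t_{n+\sigma}}^{\nu}y_N+\frac2h\left(a_N^ny_{\bar x,N}^{(\sigma)}-\beta a_1^ny_{x,0}^{(\sigma)}-\gamma y_N^{(\sigma)}\right)=\frac2h\mu(t_{n+\sigma})+\varphi_N^n+\beta\varphi_0^n,\quad 0\le n\le N_T-1,$$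 $$y_i^0=u_0(x_i),\quad 0\le i\le N,$$ satisfies, for all $0\le n\le N_T-1$, $$|[y^{n+1}]|_0^2\le M_3\left(|[y^0]|_0^2+\max_{0\le m\le N_T-1}\left(|[\varphi^{m}]|_0^2+\mu^2(t_{m+\sigma})\right)\right).$$
   Context: Notation: $\sigma=1-\nu/2$; $x_i=ih$, $t_n=n\tau$, $t_{n+\sigma}=t_n+\sigma\tau$; $a_i^n=k(x_i-0.5h,t_{n+\sigma})$ for $1\le i\le N$; $\varphi_i^n=f(x_i,t_{n+\sigma})$; $y_{\bar x,i}=(y_i-y_{i-1})/h$, $y_{x,i}=(y_{i+1}-y_i)/h$, $(ay_{\bar x})_{x,i}=(a_{i+1}y_{i+1}-(a_{i+1}+a_i)y_i+a_iy_{i-1})/h^2$ with $a=a^n$ at time level $n$; $y_i^{(\sigma)}=\sigma y_i^{n+1}+(1-\sigma)y_i^n$; $y_{t,i}^s=(y_i^{s+1}-y_i^s)/\tau$. The discrete Caputo derivative (L2-$1_\sigma$ formula) is $$\Delta_{0t_{n+\sigma}}^{\nu}y_i=\frac{\tau^{1-\nu}}{\Gamma(2-\nu)}\sum_{s=0}^nc_{n-s}^{(\nu,\sigma)}y_{t,i}^s,$$ where $a_0^{(\nu,\sigma)}=\sigma^{1-\nu}$ and, for $l\ge1$, $$a_l^{(\nu,\sigma)}=(l+\sigma)^{1-\nu}-(l-1+\sigma)^{1-\nu},$$ $$b_l^{(\nu,\sigma)}=\frac1{2-\nu}\left[(l+\sigma)^{2-\nu}-(l-1+\sigma)^{2-\nu}\right]-\frac12\left[(l+\sigma)^{1-\nu}+(l-1+\sigma)^{1-\nu}\right];$$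 for $n=0$, $c_0^{(\nu,\sigma)}=a_0^{(\nu,\sigma)}$; for $n\ge1$, $c_0^{(\nu,\sigma)}=a_0^{(\nu,\sigma)}+b_1^{(\nu,\sigma)}$, $c_s^{(\nu,\sigma)}=a_s^{(\nu,\sigma)}+b_{s+1}^{(\nu,\sigma)}-b_s^{(\nu,\sigma)}$ for $1\le s\le n-1$, and $c_n^{(\nu,\sigma)}=a_n^{(\nu,\sigma)}-b_n^{(\nu,\sigma)}$. Norm: $|[y]|_0^2=\sum_{i=0}^{N}y_i^2h$. *)

(* Defs.v *)
From HB Require Import structures.
From mathcomp Require Import all_boot all_order all_algebra.
From mathcomp Require Import all_classical all_reals all_analysis.
Import Order.TTheory GRing.Theory Num.Theory.
Import numFieldNormedType.Exports.
Set Implicit Arguments.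
Unset Strict Implicit.
Unset Printing Implicit Defensive.
Local Open Scope classical_set_scope.
Local Open Scope ring_scope.

(* Euler's Gamma function, meaningful for x > 0 (where the integral is
   finite). *)
Definition Gamma (R : realType) (x : R) : R :=
  \int[lebesgue_measure]_(t in `]0, +oo[) (t `^ (x - 1) * expR (- t)).

Section L2_1sigma.
Variables (R : realType) (nu : R).

Definition sigma : R := 1 - nu / 2.

Definition acoef (l : nat) : R :=
  if l is 0%N then sigma `^ (1 - nu)
  else (l%:R + sigma) `^ (1 - nu) - (l%:R - 1 + sigma) `^ (1 - nu).

(* Only used for l >= 1. *)
Definition bcoef (l : nat) : R :=
  (2 - nu)^-1 *
    ((l%:R + sigma) `^ (2 - nu) - (l%:R - 1 + sigma) `^ (2 - nu))
  - 2^-1 * ((l%:R + sigma) `^ (1 - nu) + (l%:R - 1 + sigma) `^ (1 - nu)).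

(* The coefficient c_s of the formula at time level n; it depends on n, and
   only the values with s <= n are meaningful. *)
Definition ccoef (n s : nat) : R :=
  if n == 0%N then acoef 0
  else if s == 0%N then acoef 0 + bcoef 1
  else if (s < n)%N then acoef s + bcoef s.+1 - bcoef s
  else acoef s - bcoef s.

Definition caputo (tau : R) (n : nat) (v : nat -> R) : R :=
  tau `^ (1 - nu) / Gamma (2 - nu) *
  \sum_(0 <= s < n.+1) ccoef n (n - s) * ((v s.+1 - v s) / tau).

Definition tsigma (tau : R) (n : nat) : R := n%:R * tau + sigma * tau.

(* A mesh function is y : nat -> nat -> R, with y n i standing for y_i^n. *)
Definition ysigma (y : nat -> nat -> R) (n i : nat) : R :=
  sigma * y n.+1 i + (1 - sigma) * y n i.

End L2_1sigma.

Section Scheme.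
Variable R : realType.

(* The backward difference, used only for i >= 1. *)
Definition dbackward (h : R) (y : nat -> R) (i : nat) : R :=
  (y i - y i.-1) / h.

Definition dforward (h : R) (y : nat -> R) (i : nat) : R :=
  (y i.+1 - y i) / h.

(* (a y_{\bar x})_{x,i}, used only for i >= 1. *)
Definition ddiv (h : R) (a y : nat -> R) (i : nat) : R :=
  (a i.+1 * y i.+1 - (a i.+1 + a i) * y i + a i * y i.-1) / h ^+ 2.

Definition norm0sq (N : nat) (h : R) (y : nat -> R) : R :=
  \sum_(0 <= i < N.+1) y i ^+ 2 * h.

Definition kmesh (nu : R) (k : R -> R -> R) (h tau : R) (n i : nat) : R :=
  k (i%:R * h - 2^-1 * h) (tsigma nu tau n).

Definition fmesh (nu : R) (f : R -> R -> R) (h tau : R) (n i : nat) : R :=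
  f (i%:R * h) (tsigma nu tau n).

Definition scheme_solution (nu alpha beta gamma : R) (k f : R -> R -> R)
    (mu u0 : R -> R) (N NT : nat) (h tau : R) (y : nat -> nat -> R) : Prop :=
  let a := kmesh nu k h tau in
  let phi := fmesh nu f h tau in
  let D n i := caputo nu tau n (fun s => y s i) in
  let ys := ysigma nu y in
  [/\ forall n i, (n < NT)%N -> (1 <= i <= N.-1)%N ->
        D n i - ddiv h (a n) (ys n) i = phi n i,
      forall n, (n < NT)%N -> y n.+1 0%N - alpha * y n.+1 N = 0,
      forall n, (n < NT)%N ->
        beta * D n 0%N + D n N
        + 2 / h * (a n N * dbackward h (ys n) N
                   - beta * a n 1%N * dforward h (ys n) 0%N
                   - gamma * ys n N)
        = 2 / h * mu (tsigma nu tau n) + phi n N + beta * phi n 0%N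
    & forall i, (i <= N)%N -> y 0%N i = u0 (i%:R * h)].

End Scheme.

(* Main.v *)
(* Test the scheme with W_i = A y_i + B y_{N-i}, where y is taken at level n + sigma and A, B are chosen so that A alpha + B = beta (A + B alpha).  Then W_0 = beta W_N, so the nonlocal flux condition is exactly what summation by parts needs; the sign conditions on alpha, beta, gamma give |B| < A and gamma y_N W_N <= 0, and the symmetry of k makes the elliptic part at least (A - |B|) c1 times the squared gradient.

   The quadratic form E(y) attached to W is equivalent to the squared norm, and y^(sigma) D y >= D(y^2) / 2 for the L2-1_sigma derivative D, since its coefficients are nonnegative, nonincreasing and satisfy sigma^2 c_1 <= (2 sigma - 1) c_0.

   A bound uniform in T comes from a maximum principle rather than a Gronwall argument: if E(y^{n+1}) exceeds all previous values then D E >= 0, so the gradient of y^(sigma), and by a Poincare inequality (alpha <> 1) y^(sigma) itself, is controlled by the data at that level alone; as sigma > 1/2, E(y^{n+1}) <= E(y^(sigma)) / (2 sigma - 1)^2. *)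
Require Import Defs.
From HB Require Import structures.
From mathcomp Require Import all_boot all_order all_algebra.
From mathcomp Require Import all_classical all_reals all_analysis.
From mathcomp Require Import ring lra zify.
Import Order.TTheory GRing.Theory Num.Theory.
Import numFieldNormedType.Exports.
Set Implicit Arguments.
Unset Strict Implicit.
Unset Printing Implicit Defensive.
Local Open Scope classical_set_scope.
Local Open Scope ring_scope.

(** * Real powers *)

Section RealPowers.
Variable R : realType.
Implicit Types x y a p q : R.

Lemma nondecreasing_of_derive_ge0 (f df : R -> R) x y :
  (forall z, x <= z <= y -> is_derive z 1 f (df z)) ->
  (forall z, x <= z <= y -> 0 <= df z) -> x <= y -> f x <= f y.
Proof.
move=> fd df0 xy.
have fd' z : z \in `]x, y[ -> is_derive z 1 f (df z).
  by rewrite in_itv/= => /andP[xz zy]; apply: fd; rewrite !ltW.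
apply: (@ger0_derive1_ndecr R f x y) => //.
- by move=> z /fd'; case.
- move=> z zxy; rewrite derive1E.
  have [_ ->] := fd' z zxy.
  by move: zxy; rewrite in_itv/= => /andP[xz zy]; apply: df0; rewrite !ltW.
- apply: derivable_within_continuous => z.
  by rewrite in_itv/= => zxy; have [] := fd z zxy.
Qed.

Lemma powR_subr1 x p : 0 < x -> x `^ (p - 1) = x `^ p / x.
Proof.
by move=> x0; rewrite powRB ?(gt_eqF x0) ?implybT// powRr1// ltW.
Qed.

(** Scaling by [x] reduces this to [z = y / x]: there [expR (q * ln z) >= 1 + q * ln z], and
    [ln z <= z - 1] is reversed by [q <= 0]. *)
Lemma powR_tangent_ge x y q : 0 < x -> 0 < y -> q <= 0 ->
  x `^ q + q * x `^ (q - 1) * (y - x) <= y `^ q.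
Proof.
move=> x0 y0 q0.
have z0 : 0 < y / x by rewrite divr_gt0.
have -> : y `^ q = x `^ q * (y / x) `^ q.
  by rewrite -powRM ?ltW// mulrC divfK// gt_eqF.
rewrite (powR_subr1 q x0).
have -> : x `^ q + q * (x `^ q / x) * (y - x) = x `^ q * (1 + q * (y / x - 1)).
  by field; rewrite gt_eqF.
rewrite ler_wpM2l ?powR_ge0//.
rewrite /powR gt_eqF//.
apply: le_trans (expR_ge1Dx _); rewrite lerD2l ler_wnM2l//.
by have := @le_ln1Dx R (y / x - 1); rewrite [1 + _]addrC subrK; apply; lra.
Qed.

Lemma powR_tangent_le x y p : 0 < x -> 0 < y -> 0 <= p <= 1 ->
  y `^ p <= x `^ p + p * x `^ (p - 1) * (y - x).
Proof.
move=> x0 y0 /andP[p0 p1].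
(* Divided by [y `^ p], this is [1 <= p * (y / x) `^ (1 - p) + (1 - p) * (y / x) `^ (- p)], and both powers lie above their tangents in [ln (y / x)]. *)
have z0 : 0 < y / x by rewrite divr_gt0.
have -> : y `^ p = x `^ p * (y / x) `^ p.
  by rewrite -powRM ?ltW// mulrC divfK// gt_eqF.
rewrite (powR_subr1 p x0).
have -> : x `^ p + p * (x `^ p / x) * (y - x) = x `^ p * (1 + p * (y / x - 1)).
  by field; rewrite gt_eqF.
rewrite ler_wpM2l ?powR_ge0//.
move: (y / x) z0 => z z0 {x0 y0}.
have zp : 0 < z `^ p by rewrite powR_gt0.
have e1 : 1 + (1 - p) * ln z <= z / z `^ p.
  have := expR_ge1Dx ((1 - p) * ln z); congr (_ <= _).
  by rewrite -{2}(@powRr1 R z) ?ltW// -powRB ?(gt_eqF z0) ?implybT// /powR gt_eqF.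
have e2 : 1 - p * ln z <= (z `^ p)^-1.
  have := expR_ge1Dx (- (p * ln z)); congr (_ <= _).
  by rewrite -powRN /powR gt_eqF// mulNr.
have : 1 <= p * (z / z `^ p) + (1 - p) * (z `^ p)^-1.
  have := ler_wpM2l p0 e1; have := @ler_wpM2l R (1 - p) _ _ _ e2.
  rewrite subr_ge0 => /(_ p1); lra.
rewrite -(ler_pM2l zp) mulr1 => /le_trans; apply.
rewrite le_eqVlt; apply/orP; left; apply/eqP; field; exact: lt0r_neq0.
Qed.

Lemma is_derive_powR_shift a p x : 0 < x + a ->
  is_derive x 1 (fun z => (z + a) `^ p) (p * (x + a) `^ (p - 1)).
Proof.
move=> xa0.
have d1 : is_derive x (1 : R) (fun z : R => z + a) (1 + 0).
  exact: is_deriveD.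
have := @is_derive1_comp R (fun u => u `^ p) (fun z => z + a) x _ _
  (@is_derive1_powR R p _ xa0) d1.
by rewrite addr0 mulr1.
Qed.

Lemma is_derive_mul_powR_shift a b p x : 0 < x + a ->
  is_derive x 1 (fun z => (z + b) * (z + a) `^ p)
    ((x + a) `^ p + (x + b) * (p * (x + a) `^ (p - 1))).
Proof.
move=> xa0.
have d1 : is_derive x (1 : R) (fun z : R => z + b) (1 + 0).
  exact: is_deriveD.
have := is_deriveM d1 (is_derive_powR_shift p xa0).
rewrite addr0 => d; refine (is_derive_eq d _).
by rewrite /GRing.scale/= mulr1 addrC.
Qed.

(** Rearranged, this says that the trapezoidal rule on [[x, x + 1]] underestimates the integral of
    the concave function [z ^ p]. Up to an additive constant, [F s] is [1 + p] times the error on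
    [[x, x + s]]. *)
Lemma trapezoid_powR x p : 0 < x -> 0 <= p <= 1 ->
  (x + (1 + p) / 2) * x `^ p <= (x + 1 - (1 + p) / 2) * (x + 1) `^ p.
Proof.
move=> x0 p01.
pose F s := (s + x) * (s + x) `^ p
  - (1 + p) / 2 * ((s + 0) * (s + x) `^ p + (s + 0) * x `^ p).
pose dF s := (1 + p) / 2 *
  ((s + x) `^ p - x `^ p - s * (p * (s + x) `^ (p - 1))).
suff : F 0 <= F 1.
  rewrite /F !add0r addr0 mul0r mul1r [1 + x]addrC; lra.
apply: (@nondecreasing_of_derive_ge0 F dF) => // s /andP[s0 s1].
- have sx0 : 0 < s + x by lra.
  have d1 := is_derive_mul_powR_shift x p sx0.
  have d2 := is_derive_mul_powR_shift 0 p sx0.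
  have d3 : is_derive s (1 : R) (fun z : R => (z + 0) * x `^ p) (x `^ p).
    have d4 : is_derive s (1 : R) (fun z : R => z + 0) (1 + 0) by exact: is_deriveD.
    have := is_deriveM d4 (is_derive_cst (x `^ p) s (1 : R)).
    move=> d; refine (is_derive_eq d _).
    by rewrite /GRing.scale/= mulr0 add0r addr0 mulr1.
  have := is_deriveB d1 (is_deriveZ ((1 + p) / 2) (is_deriveD d2 d3)).
  move=> d; refine (is_derive_eq d _).
  have -> : (s + x) * (p * (s + x) `^ (p - 1)) = p * (s + x) `^ p.
    rewrite mulrCA; congr (_ * _).
    by rewrite powR_subr1// mulrC divfK// gt_eqF.
  rewrite /GRing.scale/= /dF; lra.
- have sx0 : 0 < s + x by lra.
  rewrite /dF mulr_ge0//; first by lra.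
  have := powR_tangent_le sx0 x0 p01; lra.
Qed.

(** For [G z = (z - a) * z ^ p], the derivative [(1 + p) * z ^ p - a * p * z ^ (p - 1)] is concave,
    so the third differences of [G] are nonpositive. [F] is minus the second difference of [G]. *)
Lemma powR_third_difference_le x a p : 0 < x -> 0 <= a -> 0 <= p <= 1 ->
  (x + 3 - a) * (x + 3) `^ p + 3 * ((x + 1 - a) * (x + 1) `^ p)
  <= 3 * ((x + 2 - a) * (x + 2) `^ p) + (x - a) * x `^ p.
Proof.
move=> x0 a0 p01; have /andP[p0 p1] := p01.
pose F z := 2 * ((z + (1 - a)) * (z + 1) `^ p)
  - ((z + (2 - a)) * (z + 2) `^ p + (z + (0 - a)) * (z + 0) `^ p).
pose dK z := (1 + p) * z `^ p - a * (p * z `^ (p - 1)).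
pose dF z := 2 * dK (z + 1) - (dK (z + 2) + dK z).
suff : F x <= F (x + 1).
  rewrite /F.
  have -> : x + 1 + 1 = x + 2 by ring.
  have -> : x + 1 + 2 = x + 3 by ring.
  rewrite !addr0; lra.
apply: (@nondecreasing_of_derive_ge0 F dF); last by lra.
- move=> z /andP[xz _].
  have dd b : 0 <= b ->
      is_derive z 1 (fun u => (u + (b - a)) * (u + b) `^ p) (dK (z + b)).
    move=> b0; have zb0 : 0 < z + b by lra.
    apply: is_derive_eq; first exact: is_derive_mul_powR_shift.
    have e : (z + b) * (p * (z + b) `^ (p - 1)) = p * (z + b) `^ p.
      rewrite mulrCA; congr (_ * _).
      by rewrite powR_subr1// mulrC divfK// gt_eqF.
    rewrite /dK; move: e; lra.
  have d0 := dd 0 (lexx 0); rewrite addr0 in d0.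
  exact: is_deriveB (is_deriveZ 2 (dd 1 ler01)) (is_deriveD (dd 2 (ler0n _ _)) d0).
- move=> z /andP[xz _].
  have z0 : 0 < z by lra.
  have z1 : 0 < z + 1 by lra.
  have z2 : 0 < z + 2 by lra.
  have c1 := powR_tangent_le z1 z0 p01.
  have c2 := powR_tangent_le z1 z2 p01.
  have q0 : p - 1 <= 0 by lra.
  have c3 := powR_tangent_ge z1 z0 q0.
  have c4 := powR_tangent_ge z1 z2 q0.
  have c12 : z `^ p + (z + 2) `^ p <= 2 * (z + 1) `^ p by lra.
  have c34 : 2 * (z + 1) `^ (p - 1) <= z `^ (p - 1) + (z + 2) `^ (p - 1) by lra.
  have ap : 0 <= a * p by rewrite mulr_ge0.
  have p10 : 0 <= 1 + p by lra.
  have := ler_wpM2l p10 c12; have := ler_wpM2l ap c34.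
  rewrite /dF /dK; lra.
Qed.

End RealPowers.

(** * The L2-1_sigma coefficients *)

Section Coefficients.
Variables (R : realType) (nu : R).
Hypotheses (hnu0 : 0 < nu) (hnu1 : nu < 1).

Local Notation sg := (sigma nu).
Local Notation f l := ((l%:R + sg) `^ (1 - nu)).

Lemma sigma_bounds : 2^-1 < sg < 1.
Proof.
have h0 := hnu0; have h1 := hnu1.
by rewrite /sigma; apply/andP; split; lra. Qed.

Let pos_node (l : nat) : 0 < l%:R + sg.
Proof.
have h0 := hnu0; have h1 := hnu1.
by have /andP[s _] := sigma_bounds; rewrite ltr_wpDl//; lra. Qed.

Let p01 : 0 <= 1 - nu <= 1. Proof.
have h0 := hnu0; have h1 := hnu1.
by apply/andP; split; lra. Qed.

Lemma acoefS l : acoef nu l.+1 = f l.+1 - f l.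
Proof. by rewrite /acoef -addn1 natrD addrK. Qed.

(** As [2 * sg = 2 - nu], this factor clears the denominator, and
    [(l + sg) ^ (2 - nu) = (l + sg) * f l] leaves only [f] at two nodes. *)
Lemma bcoefS l :
  2 * sg * bcoef nu l.+1 = l.+1%:R * f l.+1 - (l%:R + 2 * sg) * f l.
Proof.
have h0 := hnu0; have h1 := hnu1.
rewrite /bcoef.
have e2 : 2 - nu = 1 + (1 - nu) by ring.
have e m : (m%:R + sg) `^ (2 - nu) = (m%:R + sg) * f m.
  by rewrite e2 powRD ?powRr1 ?(gt_eqF (pos_node m)) ?implybT// ltW.
have -> : l.+1%:R - 1 = l%:R :> R by rewrite -addn1 natrD addrK.
rewrite !e -addn1 natrD /sigma; field; lra.
Qed.

(* The value [sigma = 1 - nu / 2] makes [int_0^sigma x^(1-nu) dx = sigma^(1-nu) / 2]; this collapses the coefficients to differences of [l * (l + sigma)^(1-nu) / (2 * sigma)]. *)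
Lemma ccoef0_first n : 2 * sg * ccoef nu n.+1 0 = f 1.
Proof.
have h0 := hnu0; have h1 := hnu1.
rewrite /ccoef/= mulrDr bcoefS /acoef !add0r; lra.
Qed.

Lemma ccoef_mid n s : (s.+1 < n)%N ->
  2 * sg * ccoef nu n s.+1 =
    s.+2%:R * f s.+2 - 2 * s.+1%:R * f s.+1 + s%:R * f s.
Proof.
move=> sn; have -> : ccoef nu n s.+1
    = acoef nu s.+1 + bcoef nu s.+2 - bcoef nu s.+1.
  by case: n sn => // n sn; rewrite /ccoef/= sn.
rewrite mulrBr mulrDr !bcoefS acoefS -[in LHS](addn1 s.+1) -[in RHS](addn1 s.+1).
rewrite -(addn1 s) !natrD; ring.
Qed.

Lemma ccoef_last n :
  2 * sg * ccoef nu n.+1 n.+1 = (2 * sg - n.+1%:R) * f n.+1 + n%:R * f n.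
Proof.
have -> : ccoef nu n.+1 n.+1 = acoef nu n.+1 - bcoef nu n.+1.
  by rewrite /ccoef/= ltnn.
rewrite mulrBr bcoefS acoefS; ring.
Qed.

Let sg2_gt0 : 0 < 2 * sg. Proof.
have h0 := hnu0; have h1 := hnu1.
by rewrite /sigma; lra. Qed.

Let f_gt0 l : 0 < f l. Proof. by rewrite powR_gt0. Qed.

Let tangent_ratio l m : f m <= f l * (1 + (1 - nu) * (m%:R - l%:R) / (l%:R + sg)).
Proof.
have := powR_tangent_le (pos_node l) (pos_node m) p01.
rewrite (powR_subr1 _ (pos_node l)) => /le_trans; apply.
rewrite le_eqVlt; apply/orP; left; apply/eqP; field.
by rewrite gt_eqF.
Qed.

(** At index [n.+1], with [p = 1 - nu], the claim is [(n - p) * f n.+1 <= n * f n]. For [n <= p] the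
    left side is nonpositive; otherwise the tangent to [f] at [n] reduces it to
    [(n - p) * (n + sg + p) <= n * (n + sg)], whose sides differ by [p * (sg + p)]. *)
Lemma ccoef_last_ge0 n : 0 <= ccoef nu n n.
Proof.
have h0 := hnu0; have h1 := hnu1.
case: n => [|n]; first exact: powR_ge0.
rewrite -(pmulr_rge0 _ sg2_gt0) ccoef_last.
have : (n%:R - (1 - nu)) * f n.+1 <= n%:R * f n.
  case: (lerP n%:R (1 - nu)) => [np|pn].
    apply: (@le_trans _ _ 0); last by rewrite mulr_ge0// ltW.
    by rewrite mulr_le0_ge0//; [lra | exact: ltW].
  have n1 : n.+1%:R - n%:R = 1 :> R by rewrite -addn1 natrD addrAC subrr add0r.
  have := tangent_ratio n n.+1; rewrite n1 mulr1 => hf.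
  apply: le_trans (ler_wpM2l _ hf) _; first by lra.
  rewrite mulrCA [n%:R * _]mulrC; apply: ler_wpM2l; first exact: ltW.
  have xn := pos_node n.
  rewrite -(ler_pM2r xn).
  have -> : (n%:R - (1 - nu)) * (1 + (1 - nu) / (n%:R + sg)) * (n%:R + sg)
      = (n%:R - (1 - nu)) * (n%:R + sg + (1 - nu)).
    by field; rewrite gt_eqF.
  have : 0 <= (1 - nu) * (sg + (1 - nu)) by rewrite mulr_ge0 /sigma//; lra.
  lra.
rewrite -(addn1 n) natrD /sigma; lra.
Qed.

Let third_difference s : s.+3%:R * f s.+3 - 3 * (s.+2%:R * f s.+2)
  + 3 * (s.+1%:R * f s.+1) - s%:R * f s <= 0.
Proof.
have h0 := hnu0; have h1 := hnu1.
have a0 : 0 <= sg by rewrite /sigma; lra.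
have := powR_third_difference_le (pos_node s) a0 p01.
have -> : s%:R + sg + 3 = s.+3%:R + sg by rewrite -addn3 natrD; ring.
have -> : s%:R + sg + 2 = s.+2%:R + sg by rewrite -addn2 natrD; ring.
have -> : s%:R + sg + 1 = s.+1%:R + sg by rewrite -addn1 natrD; ring.
rewrite !addrK; lra.
Qed.

(** By [bcoefS], this is the nonnegativity of [bcoef nu n.+1]. *)
Let trapezoid_node n : (n%:R + 2 * sg) * f n <= n.+1%:R * f n.+1.
Proof.
have h0 := hnu0; have h1 := hnu1.
have := trapezoid_powR (pos_node n) p01.
have -> : n%:R + sg + 1 = n.+1%:R + sg by rewrite -addn1 natrD; ring.
have -> : (1 + (1 - nu)) / 2 = sg by rewrite /sigma; lra.
rewrite addrK; congr (_ <= _); ring.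
Qed.

(** Here [1 - nu = 2 * sg - 1]. If index 1 is the last one, the claim is [sg ^ 2 <= 1] up to a
    nonnegative factor. Otherwise the tangent to [f] at 1 reduces it to [2 * sg ^ 2 <= 1 + sg], that
    is [(1 - sg) * (1 + 2 * sg) >= 0]. *)
Lemma ccoef_sigma_first n :
  sg ^+ 2 * ccoef nu n.+1 1 <= (1 - nu) * ccoef nu n.+1 0.
Proof.
have h0 := hnu0; have h1 := hnu1.
rewrite -(ler_pM2l sg2_gt0) !(mulrCA (2 * sg)) ccoef0_first.
have f1 := f_gt0 1.
case: n => [|n].
  rewrite (ccoef_last 0) mul0r addr0 mulrA; apply: ler_wpM2r; first exact: ltW.
  have := @mulr_ge0 R (nu / 2) _ _ (@mulr_ge0 R (2 - nu / 2) (1 - nu) _ _).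
  rewrite /sigma; lra.
rewrite ccoef_mid// mul0r addr0.
have h : f 2 <= f 1 * (1 + (1 - nu) / (1 + sg)).
  by have := tangent_ratio 1 2; rewrite (_ : 2%:R - 1%:R = 1) ?mulr1//; ring.
have s0 : 0 <= sg ^+ 2 * 2 by rewrite mulr_ge0 ?sqr_ge0.
have h2 := ler_wpM2l s0 h.
suff k : sg ^+ 2 * 2 * (1 + (1 - nu) / (1 + sg)) <= 2 * sg ^+ 2 + (1 - nu).
  have := ler_wpM2l (ltW f1) k; lra.
have : sg ^+ 2 * 2 / (1 + sg) <= 1.
  rewrite ler_pdivrMr; last by rewrite /sigma; lra.
  have := @mulr_ge0 R (nu / 2) (3 - nu); rewrite /sigma; lra.
have p0 : 0 <= 1 - nu by lra.
move=> /(ler_wpM2l p0); lra.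
Qed.

(** The first step follows from [ccoef_sigma_first] and [1 - nu <= sg ^ 2]. Later coefficients are
    second differences, ordered by the third-difference inequality; the last one lacks a term
    [bcoef], whose sign is given by [trapezoid_node]. *)
Lemma ccoefS_le n s : (s < n)%N -> ccoef nu n s.+1 <= ccoef nu n s.
Proof.
have h0 := hnu0; have h1 := hnu1.
case: s => [|s] sn.
  case: n sn => // n _.
  have c00 : 0 <= ccoef nu n.+1 0.
    by rewrite -(pmulr_rge0 _ sg2_gt0) ccoef0_first ltW.
  have s2 : 0 < sg ^+ 2 by rewrite exprn_gt0// /sigma; lra.
  rewrite -(ler_pM2l s2); apply: le_trans (ccoef_sigma_first n) _.
  rewrite ler_wpM2r//.
  have := sqr_ge0 (nu / 2); rewrite /sigma; lra.
rewrite -(ler_pM2l sg2_gt0) (ccoef_mid sn).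
move: sn; rewrite leq_eqVlt => /orP[/eqP <-|sn].
  rewrite ccoef_last.
  have := third_difference s; have := trapezoid_node s.+2.
  rewrite -(addn1 s.+2) natrD; lra.
rewrite (ccoef_mid sn); have := third_difference s; lra.
Qed.

End Coefficients.

(** * The discrete fractional derivative *)

Section MemoryOperator.
Variable R : realType.
Implicit Types (c v e : nat -> R) (n s : nat).

Definition memory c n v : R := \sum_(0 <= s < n.+1) c (n - s)%N * (v s.+1 - v s).

Definition increment e s : R := e s - (if s is s'.+1 then e s' else 0).

Lemma sum_increment e n : \sum_(0 <= s < n.+1) increment e s = e n.
Proof.
elim: n => [|n IH]; first by rewrite big_nat1 /increment subr0.
by rewrite big_nat_recr//= IH /increment addrC subrK.
Qed.

(** Abel summation against the newest value. When [c] is nonnegative and nonincreasing the new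
    weights are nonnegative, which gives both the maximum principle and the inequality for
    squares. *)
Lemma memoryE c n v : memory c n v =
  \sum_(0 <= s < n.+1) increment (fun s => c (n - s)%N) s * (v n.+1 - v s).
Proof.
suff abel e V : \sum_(0 <= s < n.+1) e s * (v s.+1 - v s) =
    \sum_(0 <= s < n.+1) increment e s * (V - v s) - e n * (V - v n.+1).
  by have := abel (fun s => c (n - s)%N) (v n.+1); rewrite subrr mulr0 subr0.
elim: n => [|n IH]; first by rewrite !big_nat1 /increment; ring.
by rewrite !(big_nat_recr n.+1)//= IH /increment; ring.
Qed.

Lemma memory_linear c n a b v w :
  memory c n (fun s => a * v s + b * w s) = a * memory c n v + b * memory c n w.
Proof.
by rewrite /memory !mulr_sumr -big_split/=; apply: eq_bigr => s _; ring.
Qed.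

Lemma memory_sum c n (I : Type) (r : seq I) (F : I -> nat -> R) :
  memory c n (fun s => \sum_(i <- r) F i s) = \sum_(i <- r) memory c n (F i).
Proof.
rewrite /memory exchange_big/=; apply: eq_bigr => s _.
by rewrite -sumrB mulr_sumr.
Qed.

Section Monotone.
Variables (c : nat -> R) (n : nat).
Hypotheses (c_noninc : forall s, (s < n)%N -> c s.+1 <= c s) (c_ge0 : 0 <= c n).

Lemma increment_ge0 s : (s <= n)%N -> 0 <= increment (fun s => c (n - s)%N) s.
Proof.
rewrite /increment; case: s => [|s] sn; first by rewrite subn0 subr0.
rewrite subr_ge0 -[X in c X](subnSK sn); apply: c_noninc.
by rewrite ltn_subrL (leq_ltn_trans _ sn).
Qed.

Lemma memory_ge0_of_max v :
  (forall s, (s <= n)%N -> v s <= v n.+1) -> 0 <= memory c n v.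
Proof.
move=> vmax; rewrite memoryE big_nat sumr_ge0// => s /=.
rewrite ltnS => sn; rewrite mulr_ge0 ?increment_ge0// subr_ge0.
exact: vmax.
Qed.

(* With [z s = v n.+1 - v s], the claim is nonnegativity of the sum of [d s * (z s ^+ 2 - 2 * (1 - sg) * z n * z s)] over [s <= n]; completing the square for [s < n] leaves a multiple of [z n ^+ 2]. *)
Lemma memory_sqr_le sg v :
  (sg ^+ 2 * c 1 <= (2 * sg - 1) * c 0 \/ n = 0%N) -> 1 <= 2 * sg ->
  memory c n (fun s => v s ^+ 2)
  <= 2 * ((sg * v n.+1 + (1 - sg) * v n) * memory c n v).
Proof.
move=> c01 sg1; rewrite -subr_ge0 !memoryE.
set d := increment _; set V := v n.+1; pose z s := V - v s.
have -> : 2 * ((sg * V + (1 - sg) * v n) * (\sum_(0 <= s < n.+1) d s * (V - v s)))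
    - \sum_(0 <= s < n.+1) d s * (V ^+ 2 - v s ^+ 2)
    = \sum_(0 <= s < n.+1) d s * (z s ^+ 2 - 2 * (1 - sg) * z n * z s).
  rewrite !mulr_sumr -sumrB; apply: eq_bigr => s _; rewrite /z; ring.
rewrite big_nat_recr//=.
apply: (@le_trans _ _ (\sum_(0 <= s < n) - (d s * ((1 - sg) * z n) ^+ 2)
    + d n * (z n ^+ 2 - 2 * (1 - sg) * z n * z n))); last first.
  rewrite lerD2r; apply: ler_sum_nat => s /= sn.
  rewrite -mulrN ler_wpM2l ?increment_ge0 1?ltnW//.
  have := sqr_ge0 (z s - (1 - sg) * z n); lra.
rewrite -mulrN1 sumrN -mulr_suml.
have z2 := sqr_ge0 (z n).
(* For [n > 0] the earlier increments sum to [c 1] and [d n = c 0 - c 1]. Since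
   [2 * sg - 1 + (1 - sg) ^ 2 = sg ^ 2], the factor equals [(2 * sg - 1) * c 0 - sg ^ 2 * c 1]. *)
suff : 0 <= ((2 * sg - 1) * d n - (1 - sg) ^+ 2 * \sum_(0 <= s < n) d s)
    by move=> /mulr_ge0/(_ z2); lra.
have cn := c_ge0.
rewrite /d; case: n cn c01 => [|m] cn c01.
  rewrite big_geq// /increment mulr0 !subr0 mulr_ge0//; lra.
case: c01 => // c01.
by rewrite sum_increment /increment subnn subSnn; lra.
Qed.

End Monotone.
End MemoryOperator.

(** * Quadratic forms pairing a mesh function with its reflected test function *)

Section ReflectedForm.
Variables (R : realType) (N : nat) (w : nat -> R).
Hypotheses (w_ge0 : forall i, (i <= N)%N -> 0 <= w i)
  (w_sym : forall i, (i <= N)%N -> w (N - i)%N = w i).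
Implicit Types (A B : R) (u v : nat -> R).

Definition reflected_form A B u v : R :=
  \sum_(0 <= i < N.+1) w i * (u i * (A * v i + B * v (N - i)%N)).

Lemma sum_reflect (F : nat -> R) :
  \sum_(0 <= i < N.+1) F i = \sum_(0 <= i < N.+1) F (N - i)%N.
Proof. by rewrite big_nat_rev/=; under eq_bigr do rewrite add0n subSS. Qed.

(** Averaging the sum with its reflection decouples the even and odd parts, on which the form acts
    through [A + B] and [A - B]. Comparing forms then amounts to comparing these two numbers. *)
Lemma reflected_formE A B u v : reflected_form A B u v =
  \sum_(0 <= i < N.+1) w i *
    ((A + B) / 4 * ((u i + u (N - i)%N) * (v i + v (N - i)%N))
     + (A - B) / 4 * ((u i - u (N - i)%N) * (v i - v (N - i)%N))).
Proof.
have half : forall x y : R, x = y -> x = (x + y) / 2.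
  by move=> x y <-; rewrite -mulr2n -[x *+ 2]mulr_natr mulfK.
rewrite /reflected_form [LHS](half _ _ (sum_reflect _)) -big_split mulr_suml/=.
apply: eq_big_nat => i; rewrite ltnS => /= iN.
by rewrite w_sym// subKn//; field.
Qed.

Lemma reflected_form_le A B A' B' v : A + B <= A' + B' -> A - B <= A' - B' ->
  reflected_form A B v v <= reflected_form A' B' v v.
Proof.
move=> h1 h2; rewrite !reflected_formE.
apply: ler_sum_nat => i; rewrite ltnS => /= iN; apply: ler_wpM2l; first exact: w_ge0.
apply: lerD; rewrite -!expr2.
  by rewrite ler_wpM2r ?sqr_ge0//; lra.
by rewrite ler_wpM2r ?sqr_ge0//; lra.
Qed.

Lemma reflected_form0 A v :
  reflected_form A 0 v v = A * \sum_(0 <= i < N.+1) w i * v i ^+ 2.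
Proof.
by rewrite /reflected_form mulr_sumr; apply: eq_bigr => i _; ring.
Qed.

Lemma reflected_form_ge A B v :
  (A - `|B|) * \sum_(0 <= i < N.+1) w i * v i ^+ 2 <= reflected_form A B v v.
Proof.
rewrite -reflected_form0; apply: reflected_form_le.
- by have := ler_norm (- B); rewrite normrN; lra.
- by have := ler_norm B; lra.
Qed.

Lemma reflected_form_le_diag A B v :
  reflected_form A B v v <= (A + `|B|) * \sum_(0 <= i < N.+1) w i * v i ^+ 2.
Proof.
rewrite -reflected_form0; apply: reflected_form_le.
- by have := ler_norm B; lra.
- by have := ler_norm (- B); rewrite normrN; lra.
Qed.

Section Positive.
Variables A B : R.
Hypothesis BA : `|B| <= A.

Let AB_ge0 : 0 <= (A + B) / 4 /\ 0 <= (A - B) / 4.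
Proof.
have h := BA; have := ler_norm B; have := ler_norm (- B); rewrite normrN.
by split; lra.
Qed.

(** The sides differ by [sg * (1 - sg)] times the form at [u + v]. When the form at [v] is at most
    the form at [u], the left side is at least [(2 * sg - 1) ^ 2] times the form at [u]. *)
Lemma reflected_form_average sg u v : 0 <= sg <= 1 ->
  (2 * sg - 1) * (sg * reflected_form A B u u - (1 - sg) * reflected_form A B v v)
  <= reflected_form A B (fun i => sg * u i + (1 - sg) * v i)
                        (fun i => sg * u i + (1 - sg) * v i).
Proof.
move=> /andP[s0 s1]; have [p q] := AB_ge0.
have st : 0 <= sg * (1 - sg) by rewrite mulr_ge0// subr_ge0.
rewrite !reflected_formE !mulr_sumr -sumrB mulr_sumr.
apply: ler_sum_nat => i; rewrite ltnS => /= iN.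
have k x y : 0 <= sg * (1 - sg) * (x + y : R) ^+ 2 by rewrite mulr_ge0 ?sqr_ge0.
have k1 := mulr_ge0 p (k (u i + u (N - i)%N) (v i + v (N - i)%N)).
have k2 := mulr_ge0 q (k (u i - u (N - i)%N) (v i - v (N - i)%N)).
have := mulr_ge0 (w_ge0 iN) (addr_ge0 k1 k2).
rewrite -subr_ge0; congr (0 <= _); ring.
Qed.

(** The form is a nonnegative combination of squares of [y i + y (N - i)] and [y i - y (N - i)], so
    [memory_sqr_le] applies to each square separately. *)
Lemma memory_reflected_form_le c n sg (y : nat -> nat -> R) :
  (forall s, (s < n)%N -> c s.+1 <= c s) -> 0 <= c n ->
  (sg ^+ 2 * c 1 <= (2 * sg - 1) * c 0 \/ n = 0%N) -> 1 <= 2 * sg ->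
  memory c n (fun s => reflected_form A B (y s) (y s)) <=
  2 * reflected_form A B (fun i => memory c n (fun s => y s i))
                         (fun i => sg * y n.+1 i + (1 - sg) * y n i).
Proof.
move=> c_noninc c_ge0 c01 sg1; have [p q] := AB_ge0.
rewrite reflected_formE mulr_sumr.
have -> : (fun s => reflected_form A B (y s) (y s)) = (fun s =>
    \sum_(0 <= i < N.+1)
      (w i * ((A + B) / 4) * (1 * y s i + 1 * y s (N - i)%N) ^+ 2
     + w i * ((A - B) / 4) * (1 * y s i + (-1) * y s (N - i)%N) ^+ 2)).
  by apply/funext => s; rewrite reflected_formE; apply: eq_bigr => i _; ring.
rewrite memory_sum.
apply: ler_sum_nat => i; rewrite ltnS => /= iN; rewrite memory_linear.
have sqr_le a := memory_sqr_le c_noninc c_ge0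
  (fun s => 1 * y s i + a * y s (N - i)%N) c01 sg1.
have wp := mulr_ge0 (w_ge0 iN) p; have wq := mulr_ge0 (w_ge0 iN) q.
have := lerD (ler_wpM2l wp (sqr_le 1)) (ler_wpM2l wq (sqr_le (-1))).
move=> /le_trans; apply; rewrite !memory_linear.
by rewrite le_eqVlt; apply/orP; left; apply/eqP; ring.
Qed.

End Positive.
End ReflectedForm.

(** * The energy identity *)

Section SpaceEnergy.
Variable R : realType.
Implicit Types (v g q : nat -> R) (N : nat).

(** Trapezoidal weights: the boundary equation multiplied by [h / 2] supplies exactly the two end
    terms of the weighted sum. *)
Definition trapw N (h : R) (i : nat) : R :=
  if (i == 0)%N || (i == N) then h / 2 else h.

Lemma trapw_ge0 N h i : 0 <= h -> 0 <= trapw N h i.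
Proof. by move=> h0; rewrite /trapw; case: ifP => _ //; lra. Qed.

Lemma trapw_le N h i : 0 <= h -> trapw N h i <= h.
Proof. by move=> h0; rewrite /trapw; case: ifP => _ //; lra. Qed.

Lemma trapw_ge N h i : 0 <= h -> h / 2 <= trapw N h i.
Proof. by move=> h0; rewrite /trapw; case: ifP => _ //; lra. Qed.

Lemma trapw_sym N h i : (i <= N)%N -> trapw N h (N - i)%N = trapw N h i.
Proof.
move=> iN; rewrite /trapw; congr (if _ then _ else _).
by lia.
Qed.

Lemma sum_trapw N h q : (0 < N)%N ->
  \sum_(0 <= i < N.+1) trapw N h i * q i
  = h / 2 * (q 0%N + q N) + \sum_(1 <= i < N) h * q i.
Proof.
case: N => // N _; rewrite big_nat_recr//= big_ltn//.
rewrite {1 3}/trapw/= eqxx.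
have -> : \sum_(1 <= i < N.+1) trapw N.+1 h i * q i = \sum_(1 <= i < N.+1) h * q i.
  by apply: eq_big_nat => i /andP[i0 iN]; rewrite /trapw gtn_eqF// ltn_eqF.
ring.
Qed.

Lemma summation_by_parts N F v : (0 < N)%N ->
  \sum_(1 <= i < N) (F i - F i.-1) * v i
  = F N.-1 * v N - F 0%N * v 0%N - \sum_(0 <= j < N) F j * (v j.+1 - v j) :> R.
Proof.
elim: N => // -[_ _|N IH _]; first by rewrite big_geq// big_nat1/=; ring.
by rewrite big_nat_recr// IH// [in RHS]big_nat_recr//=; ring.
Qed.

(** Test the inner equations with [h * W i] and the boundary equation with [h / 2 * W N]. Since
    [W 0 = b * W N], the end fluxes left by summation by parts combine into
    [(F N.-1 - b * F 0) * W N], which the boundary equation cancels. *)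
Lemma energy_identity N h a v W D phi b gm m :
  (0 < N)%N -> h != 0 ->
  (forall i, (1 <= i <= N.-1)%N -> D i - ddiv h a v i = phi i :> R) ->
  b * D 0%N + D N + 2 / h * (a N * dbackward h v N
     - b * a 1%N * dforward h v 0%N - gm * v N)
    = 2 / h * m + phi N + b * phi 0%N ->
  W 0%N = b * W N ->
  \sum_(0 <= i < N.+1) trapw N h i * (D i * W i)
  + h^-1 * \sum_(0 <= j < N) a j.+1 * ((v j.+1 - v j) * (W j.+1 - W j))
  = \sum_(0 <= i < N.+1) trapw N h i * (phi i * W i) + m * W N + gm * v N * W N.
Proof.
move=> N0 h0 inner bdry W0.
pose F j := a j.+1 * (v j.+1 - v j) / h.
have -> : h^-1 * \sum_(0 <= j < N) a j.+1 * ((v j.+1 - v j) * (W j.+1 - W j))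
    = \sum_(0 <= j < N) F j * (W j.+1 - W j).
  by rewrite mulr_sumr; apply: eq_bigr => j _; rewrite /F; ring.
rewrite !sum_trapw//.
have -> : \sum_(1 <= i < N) h * (D i * W i) =
    \sum_(1 <= i < N) h * (phi i * W i) + \sum_(1 <= i < N) (F i - F i.-1) * W i.
  rewrite -big_split; apply: eq_big_nat => -[//|i] /andP[i0 iN].
  have <- : D i.+1 - ddiv h a v i.+1 = phi i.+1 by apply: inner; lia.
  by rewrite /= /ddiv /F/=; field.
rewrite summation_by_parts// W0.
have bd : h / 2 * (b * D 0%N + D N) =
    m + h / 2 * (phi N + b * phi 0%N) - (F N.-1 - b * F 0%N - gm * v N).
  have -> : b * D 0%N + D N = 2 / h * m + phi N + b * phi 0%N -
      2 / h * (a N * dbackward h v N - b * a 1%N * dforward h v 0%N - gm * v N).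
    by rewrite -bdry addrK.
  by rewrite /F /dbackward /dforward prednK//; field.
have -> : h / 2 * (D 0%N * (b * W N) + D N * W N)
    = (h / 2 * (b * D 0%N + D N)) * W N by ring.
by rewrite bd; ring.
Qed.

Lemma sqr_sum_le n g :
  (\sum_(0 <= j < n) g j) ^+ 2 <= n%:R * \sum_(0 <= j < n) g j ^+ 2.
Proof.
elim: n => [|n IH]; first by rewrite !big_geq// expr0n mul0r.
rewrite !big_nat_recr//=; move: IH.
set S := \sum_(_ <= _ < _) g _; set Q := \sum_(_ <= _ < _) _ ^+ 2 => IH.
have Q0 : 0 <= Q by rewrite sumr_ge0// => i _; rewrite sqr_ge0.
(* After multiplication by [n > 0], this follows from [(S - n * g n) ^ 2 >= 0] and the induction
   hypothesis. *)
suff cross : 2 * S * g n <= Q + n%:R * g n ^+ 2.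
  by rewrite -(addn1 n) natrD; move: cross IH; lra.
have [n0|n0] := posnP n.
  have -> : S = 0 by rewrite /S n0 big_geq.
  by rewrite n0 mulr0 !mul0r addr0.
have n0' : 0 < n%:R :> R by rewrite ltr0n.
rewrite -(ler_pM2l n0').
have := sqr_ge0 (S - n%:R * g n); move: IH; lra.
Qed.

(** The condition gives [v N - v 0 = (1 - al) * v N], so the increments control [v N], hence [v 0],
    hence every [v i]. For [h = 1 / N] the factor [N * sum] is the squared norm of the difference
    quotient. *)
Lemma poincare_nonlocal N al v i : al != 1 -> v 0%N = al * v N -> (i <= N)%N ->
  v i ^+ 2 <= 2 * (al ^+ 2 / (1 - al) ^+ 2 + 1)
    * (N%:R * \sum_(0 <= j < N) (v j.+1 - v j) ^+ 2).
Proof.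
move=> al1 v0 iN; set P := N%:R * _.
have part k : (k <= N)%N -> (v k - v 0%N) ^+ 2 <= P.
  move=> kN; rewrite -(telescope_sumr v (leq0n k)).
  apply: le_trans (sqr_sum_le _ _) _.
  apply: ler_pM; rewrite ?ler0n ?ler_nat//.
    by rewrite sumr_ge0// => j _; rewrite sqr_ge0.
  by rewrite [leRHS](big_cat_nat _ kN)//= lerDl sumr_ge0// => j _; rewrite sqr_ge0.
have c0 : 0 < (1 - al) ^+ 2.
  by rewrite lt_def sqr_ge0 andbT sqrf_eq0 subr_eq0 eq_sym.
have vN : v N ^+ 2 <= P / (1 - al) ^+ 2.
  rewrite ler_pdivlMr//; have := part N (leqnn N).
  by rewrite v0; congr (_ <= _); ring.
have v02 : v 0%N ^+ 2 <= al ^+ 2 / (1 - al) ^+ 2 * P.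
  rewrite v0 exprMn; have := ler_wpM2l (sqr_ge0 al) vN; lra.
have := part i iN; have := sqr_ge0 (v i - 2 * v 0%N); lra.
Qed.

(** Reflection reverses the sign of a difference, so the gradient of the test function is a
    reflected form on [N.-1] with [- B] in place of [B]. *)
Lemma gradient_coercive N a c1 A B g : (0 < N)%N -> 0 <= c1 -> `|B| <= A ->
  (forall j, (j < N)%N -> c1 <= a j.+1) ->
  (forall j, (j < N)%N -> a (N - j)%N = a j.+1) ->
  (A - `|B|) * c1 * \sum_(0 <= j < N) g j ^+ 2
  <= \sum_(0 <= j < N) a j.+1 * (g j * (A * g j - B * g (N.-1 - j)%N)).
Proof.
case: N => // N _ c10 BA a_ge a_sym /=.
have w0 i : (i <= N)%N -> 0 <= a i.+1 by move=> iN; apply: le_trans (a_ge i _).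
have ws i : (i <= N)%N -> a (N - i).+1 = a i.+1.
  by move=> iN; rewrite -subSn// a_sym.
have := reflected_form_ge w0 ws A (- B) g.
rewrite normrN /reflected_form; under [leRHS]eq_bigr do rewrite mulNr.
apply: le_trans; rewrite -mulrA; apply: ler_wpM2l; first by rewrite subr_ge0.
rewrite mulr_sumr; apply: ler_sum_nat => i; rewrite ltnS => /= iN.
by rewrite ler_wpM2r ?sqr_ge0// a_ge.
Qed.

(** The linear relation is solved by multiples of [(1 - al * be, be - al)]. Then [A ^ 2 - B ^ 2 = (1
    - al ^ 2) * (1 - be ^ 2)] and [A + B * al = s * (1 - al ^ 2)]; the sign [s] makes [A] positive,
    so it is [-1] exactly when [al * be > 1]. *)
Lemma test_function_exists (al be gm : R) :
  [/\ `|al| < 1, `|be| < 1 & gm <= 0] \/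
  [/\ 1 < `|al|, 1 < `|be| & al * be * gm <= 0] ->
  exists A B : R, [/\ `|B| < A, A * al + B = be * (A + B * al)
                    & gm * (A + B * al) <= 0].
Proof.
move=> H.
have sq x : x ^+ 2 = `|x| ^+ 2 :> R by rewrite real_normK ?num_real.
suff [s [s1 sX sg0 ab]] : exists s : R,
    [/\ s ^+ 2 = 1, 0 < s * (1 - al * be), gm * (s * (1 - al ^+ 2)) <= 0
      & 0 < (1 - al ^+ 2) * (1 - be ^+ 2)].
  exists (s * (1 - al * be)), (s * (be - al)); split.
  - rewrite -(@ltr_pXn2r _ 2)// ?nnegrE ?normr_ge0 ?ltW// -sq !exprMn s1.
    by move: ab; lra.
  - by ring.
  - by move: sg0; congr (gm * _ <= 0); ring.
case: H => [[a1 b1 g0]|[a1 b1 abg]].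
  have a2 : al ^+ 2 < 1 by rewrite sq exprn_ilt1.
  have b2 : be ^+ 2 < 1 by rewrite sq exprn_ilt1.
  exists 1; rewrite expr1n !mul1r; split=> //.
  - by have := sqr_ge0 (al - be); lra.
  - by rewrite mulr_le0_ge0//; lra.
  - by rewrite mulr_gt0 ?subr_gt0.
have a2 : 1 < al ^+ 2 by rewrite sq exprn_egt1.
have b2 : 1 < be ^+ 2 by rewrite sq exprn_egt1.
have ab2 : 0 < (1 - al ^+ 2) * (1 - be ^+ 2).
  by rewrite -mulrNN mulr_gt0//; lra.
have ab1 : 1 < (al * be) ^+ 2.
  by rewrite exprMn; move: ab2; lra.
have [ab|ab] := ltrP (al * be) 0.
  exists 1; rewrite expr1n !mul1r; split=> //; first by lra.
  rewrite mulr_ge0_le0//; last by lra.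
  by move: abg; rewrite nmulr_rle0.
exists (-1); rewrite sqrrN expr1n !mulN1r !opprB; split=> //.
  by rewrite subr_gt0 -(@ltr_pXn2r _ 2)// ?nnegrE// expr1n.
rewrite mulr_le0_ge0//; last by lra.
move: abg; rewrite pmulr_rle0// lt_def ab andbT.
by apply: contraTneq ab1 => ->; rewrite expr0n/= ltr10.
Qed.

End SpaceEnergy.

(** * From the energy identity to a gradient bound at one level, and mesh facts *)

Section Assembly.
Variable R : realType.

Definition poincare_const (al : R) := 2 * (al ^+ 2 / (1 - al) ^+ 2 + 1).

Definition gradient_const (al A B c1 : R) :=
  3 * (2 * (A ^+ 2 + B ^+ 2) * poincare_const al) / ((A - `|B|) * c1) ^+ 2.

Lemma poincare_const_gt0 al : 0 < poincare_const al.
Proof.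
have : 0 <= al ^+ 2 / (1 - al) ^+ 2 by rewrite divr_ge0 ?sqr_ge0.
by rewrite /poincare_const; lra.
Qed.

Lemma gradient_const_gt0 al A B c1 :
  `|B| < A -> 0 < c1 -> 0 < gradient_const al A B c1.
Proof.
move=> BA c10; have A0 : 0 < A by apply: le_lt_trans BA.
have cp := poincare_const_gt0 al.
have A2 : 0 < A ^+ 2 + B ^+ 2 by rewrite ltr_wpDr ?sqr_ge0// exprn_gt0.
rewrite /gradient_const; apply: divr_gt0; last by rewrite exprn_gt0// mulr_gt0// subr_gt0.
by rewrite mulr_gt0 ?ltr0n// mulr_gt0// mulr_gt0 ?ltr0n.
Qed.

Lemma gradient_bound (N : nat) (a v D phi : nat -> R) (al be gm m A B c1 : R) :
  (0 < N)%N -> al != 1 -> `|B| < A -> A * al + B = be * (A + B * al) ->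
  gm * (A + B * al) <= 0 -> 0 < c1 ->
  (forall j, (j < N)%N -> c1 <= a j.+1) ->
  (forall j, (j < N)%N -> a (N - j)%N = a j.+1) ->
  v 0%N = al * v N ->
  (forall i, (1 <= i <= N.-1)%N -> D i - ddiv N%:R^-1 a v i = phi i) ->
  be * D 0%N + D N + 2 / N%:R^-1 * (a N * dbackward N%:R^-1 v N
     - be * a 1%N * dforward N%:R^-1 v 0%N - gm * v N)
    = 2 / N%:R^-1 * m + phi N + be * phi 0%N ->
  0 <= reflected_form N (trapw N N%:R^-1) A B D v ->
  N%:R * \sum_(0 <= j < N) (v j.+1 - v j) ^+ 2
  <= gradient_const al A B c1 * (norm0sq N N%:R^-1 phi + m ^+ 2).
Proof.
move=> N0 al1 BA ABW gm0 c10 a_ge a_sym v0 inner bdry DW.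
have Npos : 0 < N%:R :> R by rewrite ltr0n.
set P := N%:R * _.
have [h0 hN] : 0 < N%:R^-1 :> R /\ N%:R * N%:R^-1 = 1 :> R.
  by rewrite invr_gt0 divff// gt_eqF.
have h1 : N%:R^-1 <= 1 :> R by rewrite invf_le1// ler1n.
pose W i := A * v i + B * v (N - i)%N.
have WN : W N = (A + B * al) * v N by rewrite /W subnn v0; ring.
have W0 : W 0%N = be * W N.
  by rewrite WN mulrA -ABW /W subn0 v0; ring.
have := energy_identity N0 (lt0r_neq0 h0) inner bdry W0.
rewrite invrK.
have -> : N%:R * \sum_(0 <= j < N) a j.+1 * ((v j.+1 - v j) * (W j.+1 - W j))
    = N%:R * \sum_(0 <= j < N) a j.+1 * ((v j.+1 - v j) *
        (A * (v j.+1 - v j) - B * (v (N.-1 - j).+1 - v (N.-1 - j)%N))).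
  congr (_ * _); apply: eq_big_nat => j /= jN; rewrite /W.
  have -> : (N - j)%N = (N.-1 - j).+1 by lia.
  have -> : (N - j.+1)%N = (N.-1 - j)%N by lia.
  by congr (_ * (_ * _)); ring.
set X := \sum_(0 <= j < N) a j.+1 * _.
have coer : (A - `|B|) * c1 * P <= N%:R * X.
  rewrite /P mulrCA; apply: ler_wpM2l; first exact: ltW.
  exact: (gradient_coercive (fun j => v j.+1 - v j) N0 (ltW c10) (ltW BA)).
move: DW; rewrite /reflected_form -/(W _) => DW id.
have gmW : gm * v N * W N <= 0.
  rewrite WN; have -> : gm * v N * ((A + B * al) * v N) = gm * (A + B * al) * v N ^+ 2.
    by ring.
  by rewrite mulr_le0_ge0 ?sqr_ge0.
have P0 : 0 <= P by rewrite mulr_ge0 ?sumr_ge0// => j _; rewrite sqr_ge0.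
set CW := 2 * (A ^+ 2 + B ^+ 2) * poincare_const al.
have CW0 : 0 < CW.
  rewrite mulr_gt0 ?poincare_const_gt0// mulr_gt0 ?ltr0n//.
  rewrite ltr_wpDr ?sqr_ge0// exprn_gt0//.
  exact: le_lt_trans BA.
(* Cauchy-Schwarz on [W i], then the Poincare inequality at both [i] and [N - i]. *)
have WP i : (i <= N)%N -> W i ^+ 2 <= CW * P.
  move=> iN; have p1 := poincare_nonlocal al1 v0 iN.
  have p2 := poincare_nonlocal al1 v0 (leq_subr i N).
  have AB0 : 0 <= A ^+ 2 + B ^+ 2 by rewrite addr_ge0 ?sqr_ge0.
  have := ler_wpM2l AB0 (lerD p1 p2); rewrite -/(poincare_const al) -/P /CW /W.
  have := sqr_ge0 (A * v (N - i)%N - B * v i); lra.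
set d := (A - `|B|) * c1 in coer *.
have d0 : 0 < d by rewrite mulr_gt0// subr_gt0.
(* With this choice each use of Young's inequality costs [d / 6 * P]. The source sum has total
   weight at most [(N + 1) * h <= 2] and costs [d / 3 * P], the boundary term [d / 6 * P]; half of
   the coercivity remains. *)
pose ep := d / (3 * CW).
have ep0 : 0 < ep by rewrite divr_gt0// mulr_gt0.
have young x i : (i <= N)%N -> x * W i <= x ^+ 2 / (2 * ep) + d / 6 * P.
  move=> iN; have w2 := ler_wpM2l (ltW ep0) (WP i iN).
  have -> : d / 6 * P = ep * (CW * P) / 2 by rewrite /ep; field; rewrite gt_eqF.
  apply: (@le_trans _ _ (x ^+ 2 / (2 * ep) + ep * W i ^+ 2 / 2)); last by lra.
  rewrite -subr_ge0.
  have -> : x ^+ 2 / (2 * ep) + ep * W i ^+ 2 / 2 - x * W i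
      = (x - ep * W i) ^+ 2 / (2 * ep) by field; rewrite gt_eqF.
  by rewrite divr_ge0 ?sqr_ge0// mulr_ge0// ltW.
have phiW : \sum_(0 <= i < N.+1) trapw N N%:R^-1 i * (phi i * W i)
    <= norm0sq N N%:R^-1 phi / (2 * ep) + d / 3 * P.
  apply: (@le_trans _ _ (\sum_(0 <= i < N.+1)
      (phi i ^+ 2 * N%:R^-1 / (2 * ep) + N%:R^-1 * (d / 6 * P)))).
    apply: ler_sum_nat => i; rewrite ltnS => /= iN.
    have Y0 : 0 <= phi i ^+ 2 / (2 * ep) + d / 6 * P.
      rewrite addr_ge0//; first by rewrite divr_ge0 ?sqr_ge0// mulr_ge0// ltW.
      by rewrite mulr_ge0// divr_ge0// ltW.
    apply: le_trans (ler_wpM2l (trapw_ge0 N i (ltW h0)) (young _ _ iN)) _.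
    by apply: le_trans (ler_wpM2r Y0 (trapw_le N i (ltW h0))) _; lra.
  rewrite big_split/= -mulr_suml lerD2l sumr_const_nat subn0 -[_ *+ _]mulr_natl.
  rewrite -(addn1 N) natrD mulrA mulrDl hN mul1r.
  have dP : 0 <= d / 6 * P by rewrite mulr_ge0// divr_ge0// ltW.
  have := ler_wpM2r dP h1; lra.
have mW := young m N (leqnn N).
have main : d / 2 * P <= (norm0sq N N%:R^-1 phi + m ^+ 2) / (2 * ep).
  by move: DW id coer gmW phiW mW; lra.
have -> : gradient_const al A B c1 = (2 * ep)^-1 * (2 / d).
  rewrite /gradient_const -/CW -/d /ep; field.
  by rewrite !gt_eqF.
rewrite -mulrA mulrCA mulrC [_^-1 * _]mulrC -ler_pdivrMr ?divr_gt0//.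
by move: main; congr (_ <= _); field; rewrite gt_eqF.
Qed.

(** A first value above [K] would exceed all earlier ones, hence be a record, which the hypothesis
    bounds by [K]. Nothing accumulates with the number of steps. *)
Lemma records_bound (NT : nat) (E : nat -> R) K :
  (forall n, (n < NT)%N -> (forall s, (s <= n)%N -> E s <= E n.+1) -> E n.+1 <= K) ->
  E 0%N <= K -> forall n, (n <= NT)%N -> E n <= K.
Proof.
move=> rec E0; elim/ltn_ind => -[//|n] IH nNT.
rewrite leNgt; apply/negP => En.
have := En; rewrite ltNge rec// => s sn.
by apply: le_trans (ltW En); apply: IH => //; apply: leq_trans nNT; apply: leqW.
Qed.

Lemma caputoE (nu tau : R) n v : caputo nu tau n v =
  tau `^ (1 - nu) / Gamma (2 - nu) / tau * memory (ccoef nu n) n v.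
Proof.
rewrite /caputo /memory -mulrA mulr_sumr !mulr_sumr.
by apply: eq_bigr => s _; ring.
Qed.

Lemma Gamma_ge0 (x : R) : 0 <= Gamma x.
Proof.
by apply: Rintegral_ge0 => t _; rewrite mulr_ge0 ?powR_ge0 ?expR_ge0.
Qed.

Lemma trapezoidal_sum_le_norm0sq N (h : R) v : 0 <= h ->
  \sum_(0 <= i < N.+1) trapw N h i * v i ^+ 2 <= norm0sq N h v.
Proof.
move=> h0; apply: ler_sum => i _; rewrite mulrC ler_wpM2l ?sqr_ge0//.
exact: trapw_le.
Qed.

Lemma norm0sq_le_trapezoidal_sum N (h : R) v : 0 <= h ->
  norm0sq N h v <= 2 * \sum_(0 <= i < N.+1) trapw N h i * v i ^+ 2.
Proof.
move=> h0; rewrite mulr_sumr; apply: ler_sum => i _.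
have := ler_wpM2l (sqr_ge0 (v i)) (trapw_ge N i h0); lra.
Qed.

Lemma tsigma_bounds (nu T : R) NT n : 0 < nu -> nu < 1 -> 0 < T ->
  (n < NT)%N -> 0 <= tsigma nu (T / NT%:R) n <= T.
Proof.
move=> nu0 nu1 T0 nNT; have /andP[s1 s2] := sigma_bounds nu0 nu1.
have NT0 : 0 < NT%:R :> R by rewrite ltr0n (leq_ltn_trans _ nNT).
have n1 : n%:R + 1 <= NT%:R :> R by rewrite natr1 ler_nat.
have n0 : 0 <= n%:R :> R by [].
rewrite /tsigma -mulrDl; apply/andP; split.
  by rewrite mulr_ge0 ?divr_ge0 ?(ltW T0)//; lra.
rewrite mulrCA -[leRHS]mulr1; apply: ler_wpM2l; first exact: ltW.
by rewrite ler_pdivrMr// mul1r; lra.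
Qed.

Lemma half_node_bounds N j :
  (j < N)%N -> 0 <= (j.+1%:R * N%:R^-1 - 2^-1 * N%:R^-1 : R) <= 1.
Proof.
move=> jN; have N0 : 0 < N%:R :> R by rewrite ltr0n (leq_ltn_trans _ jN).
have j1 : j.+1%:R <= N%:R :> R by rewrite ler_nat.
have j0 : 1 <= j.+1%:R :> R by rewrite ler1n.
rewrite -mulrBl; apply/andP; split.
  by rewrite divr_ge0//; lra.
by rewrite ler_pdivrMr//; lra.
Qed.

End Assembly.

(** * Stability uniform in the mesh and the final time *)

Theorem theorem4 (R : realType) (nu alpha beta gamma c1 c2 : R)
  (hnu0 : 0 < nu) (hnu1 : nu < 1) (hc1 : 0 < c1)
  (hcoef : [/\ `|alpha| < 1, `|beta| < 1 & gamma <= 0] \/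
           [/\ 1 < `|alpha|, 1 < `|beta| & alpha * beta * gamma <= 0]) :
  exists2 M3 : R, 0 < M3 &
  forall (T : R) (k f : R -> R -> R) (mu u0 : R -> R),
    0 < T ->
    {within `[0, 1] `*` `[0, T], continuous (fun z : R * R => k z.1 z.2)} ->
    {within `[0, 1] `*` `[0, T], continuous (fun z : R * R => f z.1 z.2)} ->
    (forall x t : R, 0 <= x <= 1 -> 0 <= t <= T -> c1 <= k x t <= c2) ->
    (forall x t : R, 0 <= x <= 1 -> 0 <= t <= T -> k x t = k (1 - x) t) ->
    {within `[0, T], continuous mu} ->
    u0 0 = alpha * u0 1 ->
  forall (N NT : nat) (y : nat -> nat -> R),
    (2 <= N)%N -> (1 <= NT)%N ->
    let h := N%:R^-1 in
    let tau := T / NT%:R in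
    scheme_solution nu alpha beta gamma k f mu u0 N NT h tau y ->
    forall n : nat, (n < NT)%N ->
      norm0sq N h (y n.+1) <=
      M3 * (norm0sq N h (y 0%N)
            + \big[Num.max/0]_(m < NT)
                (norm0sq N h (fmesh nu f h tau m)
                 + mu (tsigma nu tau m) ^+ 2)).
Proof.
have [A [B [BA ABW gm0]]] := test_function_exists hcoef.
have al1 : alpha != 1.
  apply/eqP => al1; case: hcoef => [[]|[]]; rewrite al1 normr1 ltxx//.
have A0 : 0 < A by apply: le_lt_trans BA.
have nBA : A + `|B| <= 2 * A by lra.
have BA' : 0 < A - `|B| by rewrite subr_gt0.
have p0 : 0 < 1 - nu by lra.
have [sg1 sg2] := andP (sigma_bounds hnu0 hnu1).
have sg_nu : 2 * sigma nu - 1 = 1 - nu by rewrite /sigma; field.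
have sg21 : 1 <= 2 * sigma nu by lra.
have sg01 : 0 <= sigma nu <= 1 by apply/andP; split; lra.
have A2 : 0 <= 2 * A by lra.
have ps : 0 <= (1 - nu) * (1 - sigma nu) by rewrite mulr_ge0//; lra.
set CG := gradient_const alpha A B c1.
have CG0 : 0 < CG := gradient_const_gt0 alpha BA hc1.
set CP := poincare_const alpha.
have CP0 : 0 < CP := poincare_const_gt0 alpha.
(* At a record level, [(2 * sigma - 1) ^ 2 * E] is at most [2 * A] times the weighted square sum of
   [v], itself at most [2 * CP * CG * M]; and [2 * sigma - 1 = 1 - nu]. *)
pose C := 4 * A * CP * CG / (1 - nu) ^+ 2.
have C0 : 0 < C.
  by rewrite divr_gt0 ?exprn_gt0// mulr_gt0// mulr_gt0// mulr_gt0.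
(* From [(A - |B|) * norm0sq <= 2 * E] and [E <= 2 * A * norm0sq (y 0) + C * M]. *)
exists (2 / (A - `|B|) * (2 * A + C)).
  by rewrite mulr_gt0 ?divr_gt0// addr_gt0// mulr_gt0.
move=> T k f mu u0 T0 _ _ hk ksym _ hu0 N NT y N2 NT1 h tau [inner bdl bdr y0].
have N0 : (0 < N)%N by apply: leq_trans N2.
have Npos : 0 < N%:R :> R by rewrite ltr0n.
have hpos : 0 < h by rewrite invr_gt0.
have hN : N%:R * h = 1 by rewrite divff// gt_eqF.
have NTpos : 0 < NT%:R :> R by rewrite ltr0n.
have tau0 : 0 < tau by rewrite divr_gt0.
(* The scheme imposes the condition at levels [n.+1]; level 0 comes from the compatibility of [u0].
   Both levels mixed in [v] therefore satisfy it. *)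
have al_bc n : (n <= NT)%N -> y n 0%N = alpha * y n N.
  case: n => [|n] nNT; last by apply/eqP; rewrite -subr_eq0 bdl.
  by rewrite !y0// mul0r hN.
pose w := trapw N h.
have w0 i : (i <= N)%N -> 0 <= w i by move=> _; exact: trapw_ge0 (ltW hpos).
have ws i : (i <= N)%N -> w (N - i)%N = w i by exact: trapw_sym.
pose E n := reflected_form N w A B (y n) (y n).
have E_le v : reflected_form N w A B v v
    <= 2 * A * \sum_(0 <= i < N.+1) w i * v i ^+ 2.
  apply: le_trans (reflected_form_le_diag w0 ws A B v) _.
  apply: ler_wpM2r => //; rewrite big_nat sumr_ge0// => i /= iN.
  by rewrite mulr_ge0 ?sqr_ge0// w0.
set M := \big[Num.max/0]_(m < NT) _.
have FM n : (n < NT)%N ->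
    norm0sq N h (fmesh nu f h tau n) + mu (tsigma nu tau n) ^+ 2 <= M.
  move=> nNT; have := @le_bigmax _ _ _ 0 (fun m : 'I_NT =>
    norm0sq N h (fmesh nu f h tau m) + mu (tsigma nu tau m) ^+ 2) (Ordinal nNT).
  by [].
have M0 : 0 <= M by exact: bigmax_ge_id.
have step n : (n < NT)%N -> (forall s, (s <= n)%N -> E s <= E n.+1) ->
    E n.+1 <= C * M.
  move=> nNT recE.
  set v := ysigma nu y n.
  have t_bounds := tsigma_bounds hnu0 hnu1 T0 nNT.
  have a_ge j : (j < N)%N -> c1 <= kmesh nu k h tau n j.+1.
    by move=> jN; have /andP[] := hk _ _ (half_node_bounds R jN) t_bounds.
  (* The half nodes [(N - j - 1/2) * h] and [(j + 1/2) * h] are symmetric about the midpoint. *)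
  have a_sym j : (j < N)%N ->
      kmesh nu k h tau n (N - j)%N = kmesh nu k h tau n j.+1.
    move=> jN; rewrite /kmesh [RHS]ksym ?half_node_bounds//.
    by rewrite natrB 1?ltnW// -(addn1 j) natrD; congr k; rewrite mulrBl hN; field.
  have v_bc : v 0%N = alpha * v N.
    by rewrite /v /ysigma !al_bc// 1?ltnW//; ring.
  set D := fun i => caputo nu tau n (fun s => y s i).
  pose K := tau `^ (1 - nu) / Gamma (2 - nu) / tau.
  have K0 : 0 <= K by rewrite !divr_ge0 ?powR_ge0 ?Gamma_ge0// ltW.
  (* At [n = 0], [ccoef] returns [acoef nu 0] at every index and the inequality would be false,
     hence the alternative. *)
  have c01 : sigma nu ^+ 2 * ccoef nu n 1 <= (2 * sigma nu - 1) * ccoef nu n 0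
      \/ n = 0%N.
    rewrite sg_nu.
    by case: (n) => [|m]; [right | left; exact: ccoef_sigma_first].
  have c_noninc s := @ccoefS_le R nu hnu0 hnu1 n s.
  have c_ge0 := ccoef_last_ge0 hnu0 hnu1 n.
  have DW : 0 <= reflected_form N w A B D v.
    have -> : reflected_form N w A B D v =
        K * reflected_form N w A B (fun i => memory (ccoef nu n) n (fun s => y s i)) v.
      rewrite /reflected_form mulr_sumr; apply: eq_bigr => i _.
      by rewrite /D caputoE -/K; ring.
    rewrite mulr_ge0// -(pmulr_rge0 _ (ltr0n R 2)).
    apply: le_trans (memory_reflected_form_le w0 ws (ltW BA) y c_noninc c_ge0 c01 sg21).
    exact: memory_ge0_of_max.
  have grad : _ <= CG * _ := gradient_bound N0 al1 BA ABW gm0 hc1 a_ge a_sym v_bc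
    (fun i => inner n i nNT) (bdr n nNT) DW.
  have v_le : \sum_(0 <= i < N.+1) w i * v i ^+ 2 <= 2 * CP * CG * M.
    apply: (@le_trans _ _ (\sum_(0 <= i < N.+1) h * (CP * CG * M))).
      apply: ler_sum_nat => i; rewrite ltnS => /= iN.
      apply: le_trans (ler_wpM2r (sqr_ge0 _) (trapw_le N i (ltW hpos))) _.
      apply: ler_wpM2l; first exact: ltW.
      apply: le_trans (poincare_nonlocal al1 v_bc iN) _.
      rewrite -[leRHS]mulrA.
      apply: ler_wpM2l; first exact: ltW.
      apply: le_trans grad _; apply: ler_wpM2l; [exact: ltW | exact: FM].
    rewrite sumr_const_nat subn0 -[_ *+ _]mulr_natl mulrA -(addn1 N) natrD mulrDl.
    have h1 : h <= 1 by rewrite invf_le1// ler1n.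
    have X0 : 0 <= CP * CG * M by rewrite mulr_ge0// mulr_ge0// ltW.
    by rewrite hN mul1r; move: (ler_wpM2r X0 h1); clear; lra.
  have := reflected_form_average w0 ws (ltW BA) (y n.+1) (y n) sg01.
  rewrite -/(E n) -/(E n.+1) => avg.
  (* The record property is used again, as [E n <= E n.+1], to absorb the negative term of [avg]. *)
  have : (1 - nu) ^+ 2 * E n.+1 <= 4 * A * CP * CG * M.
    apply: le_trans (le_trans avg (le_trans (E_le v) _)); last first.
      by move: (ler_wpM2l A2 v_le); clear; lra.
    rewrite sg_nu; move: (ler_wpM2l ps (recE n (leqnn n))).
    by rewrite /sigma; clear; lra.
  move=> hE; rewrite -(ler_pM2l (exprn_gt0 2 p0)); move: hE; congr (_ <= _).
  by rewrite [RHS]mulrA [_ * C]mulrC divfK// gt_eqF// exprn_gt0.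
move=> n nNT.
have E0 : E 0%N <= 2 * A * norm0sq N h (y 0%N).
  apply: le_trans (E_le _) _; apply: ler_wpM2l; first exact: A2.
  exact: trapezoidal_sum_le_norm0sq (ltW hpos).
have y0_ge0 : 0 <= norm0sq N h (y 0%N).
  by rewrite sumr_ge0// => i _; rewrite mulr_ge0 ?sqr_ge0// ltW.
have CM0 : 0 <= C * M by rewrite mulr_ge0// ltW.
have Ay0 : 0 <= 2 * A * norm0sq N h (y 0%N) by rewrite mulr_ge0.
have En : E n.+1 <= 2 * A * norm0sq N h (y 0%N) + C * M.
  apply: (records_bound (NT := NT)) => //; last by apply: le_trans E0 _; rewrite lerDl.
  by move=> m mNT /(step m mNT) /le_trans; apply; rewrite lerDr.
have nE : (A - `|B|) * norm0sq N h (y n.+1) <= 2 * E n.+1.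
  have := reflected_form_ge w0 ws A B (y n.+1).
  have := ler_wpM2l (ltW BA') (norm0sq_le_trapezoidal_sum N (y n.+1) (ltW hpos)).
  by rewrite -/(E n.+1); clear; lra.
have cancel x : (A - `|B|) * (2 / (A - `|B|) * x) = 2 * x.
  by field; rewrite gt_eqF.
rewrite -(ler_pM2l BA') -[X in _ <= _ * X]mulrA cancel.
have Cy0 : 0 <= C * norm0sq N h (y 0%N) by rewrite mulr_ge0// ltW.
have AM : 0 <= A * M by rewrite mulr_ge0// ltW.
by move: nE En Cy0 AM; clear; lra.
Qed.
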